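(* Assume the setting described in the context. Suppose that Assumption (A1) and Assumption (A2) hold. Then for every compact interval $I\subset(0,\infty)$ and every $r>0$, \[\lim_{n\rightarrow\infty}\sup_{x\in B_F(\rho,r)}\sup_{t\in I}\left|\beta(n)q^n_{\lfloor\gamma(n)t\rfloor}(g_n(x))-q_t(x)\right|=0. \qquad (\ast)\] Conversely, suppose that $V(G^n)\subseteq F$ for every $n$, that Assumption (A1) holds, and that $(\ast)$ holds for every compact interval $I\subset(0,\infty)$ and every $r>0$. Then Assumption (A2) holds.
   Context: Let $(E,d_E)$ be a metric space and $F\subseteq E$ such that $F\cap\overline{B}_E(x,r)$ is compact for all $x\in E$, $r>0$; here $\overline{B}_E(x,r)$, $B_E(x,r)$ are the closed and open balls of $(E,d_E)$. Let $d_F:=d_E|_{F\times F}$ and let $B_F(x,r)$ be the open ball in $(F,d_F)$. Fix $\rho\in F$, a Radon measure $\nu$ of full support on $(F,d_F)$ (regarded also as a Borel measure on $E$ via $\nu(A):=\nu(A\cap F)$), and a function $(q_t(x))_{x\in F,t>0}$, jointly continuous in $(t,x)$, with $q_t\geq 0$ and $\int_F q_t\,d\nu=1$ for each $t>0$. For a locally finite connected graph $G$ with at least two vertices, vertex set $V(G)$, edge set $E(G)$ and distinguished vertex $\rho(G)$: $d_G$ is the shortest-path metric and $B_G(x,r)$ the open $d_G$-ball; $\mu^G:V(G)^2\to[0,\infty)$ is a symmetric weight with $\mu^G_{xy}>0$ iff $\{x,y\}\in E(G)$; $\mu^G_x:=\sum_y\mu^G_{xy}$; $\nu^G(A):=\sum_{x\in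 A}\mu^G_x$. The discrete time simple random walk $X^G=(X^G_m)_{m\ge0}$ is the Markov chain with transition probabilities $P_G(x,y)=\mu^G_{xy}/\mu^G_x$, with law $\mathbf{P}^G_x$ when started at $x$. Set $p^G_m(x,y):=\mathbf{P}^G_x(X^G_m=y)/\nu^G(\{y\})$, $q^G_m(x,y):=\frac12(p^G_m(x,y)+p^G_{m+1}(x,y))$ and $q^G_m(x):=q^G_m(\rho(G),x)$. Let $(G^n)_{n\ge1}$ be locally finite connected graphs with $\#V(G^n)\ge2$, $V(G^n)\subseteq E$, $\rho(G^n)=\rho$; write $\nu^n,X^n,q^n,\mathbf{P}^{G^n}$ for $\nu^{G^n},X^{G^n},q^{G^n}$, etc. Let $(\alpha(n)),(\beta(n)),(\gamma(n))$ be non-negative sequences diverging to $\infty$. For $x\in E$, $g_n(x)$ denotes a point of $V(G^n)$ minimising $d_E(x,y)$ over $y\in V(G^n)$ (such a point exists under (A1)). Assumption (A1): (a) there is $c_1>0$ with $d_{G^n}(x,y)\ge c_1\alpha(n)d_E(x,y)$ for all $x,y\in V(G^n)$, $n\ge1$; and there is a non-negative sequence $\tilde\alpha(n)=o(\alpha(n))$ such that for each $r>0$ there exist $c_2<\infty$ and $n_0$ with $d_{G^n}(x,y)\le c_2\alpha(n)d_E(x,y)+\tilde\alpha(n)$ for all $x,y\in V(G^n)\cap B_E(\rho,r)$, $n\ge n_0$. (b) For each $r>0$, $\lim_{n}\sup_{x\in B_F(\rho,r)}d_E(x,V(G^n))=0$. (c) For every $x\in F$, $r>0$, $\lim_n\beta(n)^{-1}\nu^n(B_E(x,r))=\nu(B_E(x,r))$.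 (d) For every compact interval $I\subset(0,\infty)$, $x\in F$, $r>0$, $\lim_n\mathbf{P}^{G^n}_\rho(X^n_{\lfloor\gamma(n)t\rfloor}\in B_E(x,r))=\int_{B_F(x,r)}q_t(y)\nu(dy)$ uniformly for $t\in I$. Assumption (A2): for every compact interval $I\subset(0,\infty)$ and $r>0$, \[\lim_{\delta\to0}\limsup_{n\to\infty}\sup_{\substack{x,y\in B_{G^n}(\rho,\alpha(n)r):\\ d_{G^n}(x,y)\le\alpha(n)\delta}}\sup_{t\in I}\beta(n)\left|q^n_{\lfloor\gamma(n)t\rfloor}(x)-q^n_{\lfloor\gamma(n)t\rfloor}(y)\right|=0.\] *)

(* Defs.v *)
From HB Require Import structures.
From mathcomp Require Import all_boot all_order all_algebra.
From mathcomp Require Import all_classical all_reals all_analysis.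
Set Implicit Arguments. Unset Strict Implicit. Unset Printing Implicit Defensive.
Import Order.TTheory GRing.Theory Num.Theory.
Local Open Scope classical_set_scope.
Local Open Scope ring_scope.

Section Metric.
Context {R : realType} {E : Type}.

Definition is_metric (dE : E -> E -> R) : Prop :=
  [/\ (forall x y, 0 <= dE x y), (forall x y, dE x y = 0 <-> x = y),
      (forall x y, dE x y = dE y x) &
      (forall x y z, dE x z <= dE x y + dE y z)].

Definition oball (dE : E -> E -> R) (x : E) (r : R) : set E := [set y | dE x y < r].
Definition cball (dE : E -> E -> R) (x : E) (r : R) : set E := [set y | dE x y <= r].

Definition dopen (dE : E -> E -> R) (A : set E) : Prop :=
  forall x, A x -> exists2 r, 0 < r & oball dE x r `<=` A.

Definition dcompact (dE : E -> E -> R) (K : set E) : Prop :=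
  forall C : set (set E), C `<=` dopen dE -> K `<=` \bigcup_(U in C) U ->
  exists D : set (set E), [/\ finite_set D, D `<=` C & K `<=` \bigcup_(U in D) U].

Definition dist_set (dE : E -> E -> R) (x : E) (A : set E) : \bar R :=
  ereal_inf [set (dE x y)%:E | y in A].
End Metric.

Section Radon.
Context {R : realType} {d : measure_display} {E : measurableType d}.

(* nu is a Borel measure on E of the form A |-> nu(A cap F) for a Radon
   measure on (F,d_F): it is concentrated on F, locally finite on F and
   inner regular by compact subsets of F. *)
Definition radon_on (dE : E -> E -> R) (F : set E)
  (nu : {measure set E -> \bar R}) : Prop :=
  [/\ (forall A, measurable A -> nu A = nu (A `&` F)),
      (forall x, F x -> exists2 r, 0 < r & (nu (oball dE x r) < +oo)%E) &
      (forall A, measurable A ->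
         nu A = ereal_sup [set nu K | K in [set K | K `<=` A `&` F /\ dcompact dE K]])].

Definition full_support_on (dE : E -> E -> R) (F : set E)
  (nu : {measure set E -> \bar R}) : Prop :=
  forall U, dopen dE U -> (exists x, F x /\ U x) -> (0 < nu (U `&` F))%E.
End Radon.

Section Graphs.
Context {R : realType} {E : choiceType}.
Implicit Types (mu : E -> E -> R) (V : set E).

Definition gwalk mu (x y : E) (k : nat) : Prop :=
  exists f : nat -> E, [/\ f 0%N = x, f k = y &
    forall i, (i < k)%N -> 0 < mu (f i) (f i.+1)].

Definition gdist mu (x y : E) : R := inf [set (k%:R : R) | k in gwalk mu x y].

Definition gball V mu (x : E) (r : R) : set E := [set y | V y /\ gdist mu x y < r].

(* (V, mu) is a locally finite connected (simple) graph with at least two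
   vertices, edge set {{x,y} : mu x y > 0}, with symmetric nonnegative
   weights mu. *)
Definition wgraph V mu : Prop :=
  (forall x y, mu x y = mu y x) /\
  (forall x y, 0 <= mu x y) /\
  (forall x y, 0 < mu x y -> V x /\ V y) /\
  (forall x, mu x x = 0) /\
  (forall x, V x -> finite_set [set y | 0 < mu x y]) /\
  (forall x y, V x -> V y -> exists k, gwalk mu x y k) /\
  (exists x y, [/\ V x, V y & x <> y]).

Definition vweight mu (x : E) : R := \sum_(y \in [set: E]) mu x y.

Definition gmeasure V mu (A : set E) : \bar R :=
  \esum_(x in A `&` V) (vweight mu x)%:E.

Definition trans mu (x y : E) : R := mu x y / vweight mu x.

Fixpoint mstep mu (m : nat) (x y : E) : R :=
  match m with
  | 0%N => \1_[set x] y
  | m'.+1 => \sum_(z \in [set: E]) mstep mu m' x z * trans mu z y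
  end.

Definition walk_prob mu (m : nat) (x : E) (A : set E) : \bar R :=
  \esum_(y in A) (mstep mu m x y)%:E.

Definition hk_p mu (m : nat) (x y : E) : R := mstep mu m x y / vweight mu y.
Definition hk_q mu (m : nat) (x y : E) : R :=
  2^-1 * (hk_p mu m x y + hk_p mu m.+1 x y).
End Graphs.

Section Assumptions.
Context {R : realType} {d : measure_display} {E : measurableType d}.
Local Open Scope ereal_scope.

Definition assumption_A1 (dE : E -> E -> R) (F : set E) (rho : E)
  (nu : {measure set E -> \bar R}) (q : R -> E -> R)
  (V : nat -> set E) (mu : nat -> E -> E -> R) (alpha beta gamma : nat -> R) : Prop :=
  ((exists2 c1 : R, (0 < c1)%R & forall n x y, V n x -> V n y ->
       (c1 * alpha n * dE x y <= gdist (mu n) x y)%R) /\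
   (exists alpha' : nat -> R,
      [/\ (forall n, 0 <= alpha' n)%R,
          (forall e : R, (0 < e)%R -> \forall n \near \oo, (alpha' n <= e * alpha n)%R) &
          (forall r : R, (0 < r)%R -> exists c2 : R, exists n0 : nat,
             forall n, (n0 <= n)%N -> forall x y, V n x -> V n y ->
               oball dE rho r x -> oball dE rho r y ->
               (gdist (mu n) x y <= c2 * alpha n * dE x y + alpha' n)%R)])) /\
  (forall r : R, (0 < r)%R ->
     (fun n => ereal_sup [set dist_set dE x (V n) | x in oball dE rho r `&` F])
       @ \oo --> 0) /\
  (forall (x : E) (r : R), F x -> (0 < r)%R ->
     (fun n => ((beta n)^-1)%:E * gmeasure (V n) (mu n) (oball dE x r))
       @ \oo --> nu (oball dE x r)) /\
  (forall (a b : R) (x : E) (r : R), (0 < a)%R -> (a <= b)%R -> F x -> (0 < r)%R ->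
     forall e : R, (0 < e)%R -> \forall n \near \oo, forall t : R, (a <= t <= b)%R ->
       `| walk_prob (mu n) (Num.truncn (gamma n * t)) rho (oball dE x r)
          - \int[nu]_(y in oball dE x r `&` F) (q t y)%:E | <= e%:E).

Definition assumption_A2 (rho : E) (V : nat -> set E) (mu : nat -> E -> E -> R)
  (alpha beta gamma : nat -> R) : Prop :=
  forall a b r : R, (0 < a)%R -> (a <= b)%R -> (0 < r)%R ->
    (fun delta : R => limn_esup (fun n =>
       ereal_sup [set ereal_sup [set
           (beta n * `| hk_q (mu n) (Num.truncn (gamma n * t)) rho xy.1
                        - hk_q (mu n) (Num.truncn (gamma n * t)) rho xy.2 |)%:E
           | t in `[a, b]%classic]
         | xy in [set xy : E * E | [/\ gball (V n) (mu n) rho (alpha n * r) xy.1,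
                                       gball (V n) (mu n) rho (alpha n * r) xy.2 &
                                       (gdist (mu n) xy.1 xy.2 <= alpha n * delta)%R]]]))
      @ 0^'+ --> 0.

Definition local_limit (dE : E -> E -> R) (F : set E) (rho : E) (q : R -> E -> R)
  (V : nat -> set E) (mu : nat -> E -> E -> R) (beta gamma : nat -> R)
  (g : nat -> E -> E) : Prop :=
  forall a b r : R, (0 < a)%R -> (a <= b)%R -> (0 < r)%R ->
    (fun n => ereal_sup [set ereal_sup [set
        (`| beta n * hk_q (mu n) (Num.truncn (gamma n * t)) rho (g n x) - q t x |)%:E
        | t in `[a, b]%classic]
      | x in oball dE rho r `&` F]) @ \oo --> 0.
End Assumptions.

(* Main.v *)
(** Write m = floor(gamma t).  Summing over a small ball B around x in F,
    P(X_m in B) + P(X_(m+1) in B) = 2 sum_(y in B) q_m(y) nu^n{y}.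
    By (A2), beta q_m is nearly constant on B, so the right-hand side is close
    to 2 beta q_m(g x) (nu^n(B) / beta); by (A1) the left-hand side is close to
    2 q_t(x) nu(B) and nu^n(B) / beta is close to nu(B) > 0.  Dividing gives
    the limit at x, and compactness of F in balls together with (A2) and the
    continuity of q makes it uniform.  The time m+1 is floor(gamma s) with
    s = t + 1/gamma, hence is covered by the uniformity in t of (A1)(d).
    Conversely, if V is contained in F then g n is the identity on V n, so (A2)
    follows from the local limit and the uniform continuity of q. *)
Require Import Defs.
From HB Require Import structures.
From mathcomp Require Import all_boot all_order all_algebra.
From mathcomp Require Import all_classical all_reals all_analysis.
From mathcomp Require Import finmap ring lra.
Import Order.TTheory GRing.Theory Num.Theory.
Local Open Scope classical_set_scope.
Local Open Scope ring_scope.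
Set Implicit Arguments. Unset Strict Implicit. Unset Printing Implicit Defensive.

(** * Limits, suprema and sums in the extended reals *)

Lemma cvge0 (R : realType) (T : Type) (H : set_system T) {HF : Filter H}
  (f : T -> \bar R) :
  (forall e : R, 0 < e -> \forall i \near H, (0 <= f i <= e%:E)%E) ->
  f @ H --> 0%E.
Proof.
(* The bound for [e = 1] already forces [f] to be eventually finite, so the limit can be checked in
   [R]. *)
move=> h; have fin : \forall i \near H, f i \is a fin_num.
  by apply: filterS (h _ ltr01) => i; case: (f i) => [r||];
    rewrite ?leye_eq ?leeNy_eq ?andbF //.
refine (proj2 (@fine_cvgP R T H HF f 0) _); split => //.
apply/cvgrPdist_le => e e0; near=> i.
have := near (h _ e0) i; have : f i \is a fin_num by near: i.
rewrite sub0r normrN /=; case: (f i) => //= r _ /(_ _)/andP.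
rewrite !lee_fin => -[//|r0 re]; by rewrite ger0_norm.
Unshelve. all: by end_near. Qed.

Lemma cvge0_le (R : realType) (T : Type) (H : set_system T) {HF : Filter H}
  (f : T -> \bar R) : f @ H --> 0%E ->
  forall e : R, 0 < e -> \forall i \near H, (f i <= e%:E)%E.
Proof.
move=> /(proj1 (fine_cvgP f 0))[fin /cvgrPdist_le h] e e0; near=> i.
have : f i \is a fin_num by near: i.
have : `|0 - (fine \o f) i| <= e by near: i; exact: h.
rewrite sub0r normrN /=; case: (f i) => //= r + _.
by rewrite lee_fin; apply: le_trans; exact: ler_norm.
Unshelve. all: by end_near. Qed.

Lemma limn_esup_le (R : realType) (u : nat -> \bar R) (x : \bar R) :
  (\forall n \near \oo, (u n <= x)%E) -> (limn_esup u <= x)%E.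
Proof.
move=> h; rewrite /limn_esup limf_esupE.
apply: (@le_trans _ _ (ereal_sup (u @` [set n | (u n <= x)%E]))).
  by apply: ereal_inf_lbound; exists [set n | (u n <= x)%E].
by apply: ge_ereal_sup => _ [n /= un <-].
Qed.

Lemma limn_esup_ge (R : realType) (u : nat -> \bar R) (x : \bar R) :
  (\forall n \near \oo, (x <= u n)%E) -> (x <= limn_esup u)%E.
Proof.
move=> h; rewrite /limn_esup limf_esupE.
apply: le_ereal_inf_tmp => _ [A Aoo <-].
have [n [An xn]] : exists n, A n /\ (x <= u n)%E.
  by apply: (@filter_ex _ \oo); apply: filterI.
by apply: (le_trans xn); apply: ereal_sup_ubound; exists n.
Qed.

Lemma limn_esup_lt (R : realType) (u : nat -> \bar R) (x : \bar R) :
  (limn_esup u < x)%E -> \forall n \near \oo, (u n <= x)%E.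
Proof.
rewrite /limn_esup limf_esupE => /ereal_inf_lt[_ [A Aoo <-] Ax].
apply: filterS Aoo => n An; apply: (le_trans _ (ltW Ax)).
by apply: ereal_sup_ubound; exists n.
Qed.

Lemma esumZl (R : realType) (T : choiceType) (A : set T) (c : R)
  (f : T -> \bar R) : 0 <= c -> (forall i, 0 <= f i)%E ->
  (\esum_(i in A) (c%:E * f i) = c%:E * \esum_(i in A) f i)%E.
Proof.
move=> c0 f0; rewrite /esum -ereal_supZl //; last first.
  (* A factor passes through a supremum over a nonempty set; the empty sum is a member. *)
  by apply/set0P; exists 0%E; exists set0; [exact: fsets_set0 | rewrite fsbig_set0].
congr ereal_sup; rewrite image_comp; apply: eq_imagel => X _ /=.
by rewrite ge0_mule_fsumr.
Qed.

(* No measurability is needed: the integral of a nonnegative function is a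
   supremum over the simple functions below it. *)
Lemma ge0_le_integral_restrict (d : measure_display) (T : measurableType d)
  (R : realType) (nu : {measure set T -> \bar R}) (A B : set T) (f h : T -> \bar R) :
  (forall x, A x -> 0 <= f x)%E -> (forall x, B x -> 0 <= h x)%E ->
  (forall x, A x -> B x /\ (f x <= h x)%E) ->
  (\int[nu]_(x in A) f x <= \int[nu]_(x in B) h x)%E.
Proof.
move=> f0 h0 fh; rewrite !ge0_integralE//; apply: ereal_sup_le => _ [k /= kf <-].
exists k => // x; apply: (le_trans (kf x)); rewrite !patchE.
case: ifPn => [/set_mem /fh [Bx] le|_]; first by rewrite mem_set.
by case: ifPn => // /set_mem; exact: h0.
Qed.

Lemma truncnS (R : realType) (x : R) : 0 <= x ->
  Num.truncn (x + 1) = (Num.truncn x).+1.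
Proof.
by move=> x0; rewrite addrC truncnD ?truncn1 ?nnegrE // rpred1.
Qed.
Lemma ereal_sup2_le (R : realType) (T U : Type) (A : set T) (B : set U)
  (f : T -> U -> R) (e : R) :
  (ereal_sup [set ereal_sup [set (f x t)%:E | t in B] | x in A] <= e%:E)%E <->
  forall x t, A x -> B t -> f x t <= e.
Proof.
split => [h x t Ax Bt|h].
  rewrite -lee_fin; apply: le_trans h; apply: le_ereal_sup_tmp.
  by exists (ereal_sup [set (f x t)%:E | t in B]);
    [exists x | apply: ereal_sup_ubound; exists t].
apply: ge_ereal_sup => _ [x Ax <-]; apply: ge_ereal_sup => _ [t Bt <-].
by rewrite lee_fin; exact: h.
Qed.

(** The supremum of an empty family is [-oo], so even nonnegativity of a nested supremum requires a
    witness. *)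
Lemma ereal_sup2_ge (R : realType) (T U : Type) (A : set T) (B : set U)
  (f : T -> U -> R) (e : R) x t : A x -> B t -> e <= f x t ->
  (e%:E <= ereal_sup [set ereal_sup [set (f x t)%:E | t in B] | x in A])%E.
Proof.
move=> Ax Bt ef; apply: le_ereal_sup_tmp.
exists (ereal_sup [set (f x t)%:E | t in B]); first by exists x.
by apply: le_ereal_sup_tmp; exists (f x t)%:E; [exists t | rewrite lee_fin].
Qed.

(** * Real inequalities behind the averaging argument *)

Lemma ler_dist_ratio (R : realFieldType) (Q K N w e : R) :
  0 < w -> w / 2 <= N -> `|Q * N - K * w| <= 4 * e * w ->
  `|K * (N - w)| <= e * w -> `|Q - K| <= 10 * e.
Proof.
move=> w0 wN h1 h2; rewrite -(ler_pM2r w0).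
have N0 : 0 <= N by lra.
(* The errors [4 * e * w] and [e * w] add up to [5 * e * w]; dividing by [N >= w / 2] doubles the
   constant. *)
have : `|(Q - K) * N| <= 5 * e * w.
  have -> : (Q - K) * N = (Q * N - K * w) - K * (N - w) by ring.
  by rewrite (le_trans (ler_normB _ _))//; lra.
rewrite normrM (ger0_norm N0).
have : `|Q - K| * (w / 2) <= `|Q - K| * N by rewrite ler_wpM2l.
lra.
Qed.

(* The hypotheses on P give K <= w^-1 + e, whence the choice of the last bound:
   it makes K * `|w - N| at most e * w. *)
Lemma ler_dist_average (R : realFieldType) (Q K N w e P P' W W' : R) :
  0 < w -> 0 < e -> 0 <= K -> P <= 1 ->
  `|P - K * w| <= e * w -> `|P' - K * w| <= e * w ->
  `|W - P| <= e * w -> `|W' - P'| <= e * w ->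
  W + W' <= 2 * (Q * N) + 2 * (e * N) -> 2 * (Q * N) <= W + W' + 2 * (e * N) ->
  `|w - N| <= Num.min (w / 2) (e * w / (w^-1 + e)) -> `|Q - K| <= 10 * e.
Proof.
move=> w0 e0 K0 P1 hP hP' hW hW' Wu Wl; set eta := Num.min _ _ => hN.
have wVe : 0 < w^-1 + e by rewrite addr_gt0// invr_gt0.
have eta_w : eta <= w / 2 by rewrite ge_min lexx.
have eta_e : eta * (w^-1 + e) <= e * w.
  by rewrite -ler_pdivlMr// ge_min lexx orbT.
have Kle : K <= w^-1 + e.
  rewrite -(ler_pM2r w0) mulrDl mulVf ?gt_eqF//.
  by move: hP; rewrite ler_norml; clear -P1; lra.
move: (hN); rewrite ler_norml => /andP[N1 N2].
have eN : e * N <= e * (2 * w) by rewrite ler_pM2l//; clear -N1 eta_w w0; lra.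
(* The constant 4: [2 * Q * N] is within [2 * e * N <= 4 * e * w] of [W + W'], which is within
   [2 * e * w] of [P + P'], itself within [2 * e * w] of [2 * K * w]; the total [8 * e * w] is then
   halved. *)
apply: (@ler_dist_ratio _ _ _ N w) => //; first by clear -N2 eta_w; lra.
  clear -hP hP' hW hW' Wu Wl eN; move: hP hP' hW hW'.
  rewrite !ler_norml => /andP[? ?] /andP[? ?] /andP[? ?] /andP[? ?].
  by apply/andP; split; lra.
rewrite normrM (ger0_norm K0) distrC mulrC; apply: le_trans eta_e.
by apply: ler_pM.
Qed.

Lemma abseB_le_EFin (R : realType) (x : \bar R) (p e : R) :
  (`|x - p%:E| <= e%:E)%E -> exists2 r : R, x = r%:E & `|r - p| <= e.
Proof. by case: x => [r||] //=; rewrite lee_fin; exists r. Qed.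

(** * Compactness in a metric space *)

Lemma oball_dopen (R : realType) (E : Type) (dE : E -> E -> R) x r :
  is_metric dE -> dopen dE (oball dE x r).
Proof.
move=> [_ _ _ dtri] y xy; exists (r - dE x y); first by rewrite subr_gt0.
by move=> z yz; rewrite /oball /= in xy yz *; have := dtri x y z; lra.
Qed.

(** The open sets on which [P i] holds eventually in [i] cover [K]; a finite subcover leaves
    finitely many conditions, which a filter can intersect. Serves both [0^'+] and [\oo]. *)
Lemma near_dcompact (R : realType) (E : Type) (dE : E -> E -> R) (K : set E)
  (I : Type) (H : set_system I) {HF : Filter H} (P : I -> E -> Prop) :
  is_metric dE -> dcompact dE K ->
  (forall x, K x -> exists2 r, 0 < r &
     \forall i \near H, forall y, K y -> dE x y < r -> P i y) ->
  \forall i \near H, forall y, K y -> P i y.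
Proof.
move=> dm Kc hP; have [_ d0 _ _] := dm.
pose C := [set U | dopen dE U /\ \forall i \near H, forall y, K y -> U y -> P i y].
have [||D [/finite_fsetP[X DX] DC KD]] := Kc C; first by move=> U [].
  move=> x Kx; have [r r0 hr] := hP x Kx.
  exists (oball dE x r); last by rewrite /oball /= (proj2 (d0 x x)).
  by split => //; exact: oball_dopen.
have hX : H (\bigcap_(U in [set` X]) [set i | forall y, K y -> U y -> P i y]).
  by apply: filter_bigI => U XU; have [] : C U by apply: DC; rewrite DX.
apply: filterS hX => i hi y Ky; have [U DU Uy] := KD y Ky.
by apply: (hi U) => //=; rewrite DX in DU.
Qed.

(** Around each [x] in [K] the distance to [y] is at least half of [dE y x]; [near_dcompact] for the
    filter [0^'+] makes the lower bound common to all of [K]. *)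
Lemma dcompact_closed (R : realType) (E : Type) (dE : E -> E -> R) (K : set E) :
  is_metric dE -> dcompact dE K -> dopen dE (~` K).
Proof.
move=> dm Kc y Ky; have [dge0 d0 dsym dtri] := dm.
have h : \forall s \near 0^'+, forall x, K x -> s <= dE y x.
  apply: near_dcompact Kc _ => // x Kx.
  have yx : 0 < dE y x.
    by rewrite lt_def dge0 andbT; apply: contra_notN Ky => /eqP/d0 ->.
  exists (dE y x / 2); first by rewrite divr_gt0.
  near=> s => z Kz xz.
  have s1 : s <= dE y x / 2 by near: s; apply: nbhs_right_le; rewrite divr_gt0.
  by have := dtri y z x; rewrite (dsym z x); lra.
have [s [s0 hs]] : exists s, 0 < s /\ forall x, K x -> s <= dE y x.
  by apply: (@filter_ex _ 0^'+); apply: filterI => //; exact: nbhs_right_gt.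
exists s => // x xy Kx; have := hs x Kx; rewrite /oball /= in xy.
by rewrite leNgt xy.
Unshelve. all: by end_near. Qed.

(** * Measurability of [F] and uniform continuity of [q], by compactness of balls *)

Section proper.
Context (R : realType) (d : measure_display) (E : measurableType d)
  (dE : E -> E -> R) (F : set E).
Hypothesis dm : is_metric dE.
Hypothesis Fc : forall x r, 0 < r -> dcompact dE (F `&` cball dE x r).

(** [F] is a countable union of compact, hence closed, sets. This makes [oball dE x r] intersected
    with [F] a legitimate domain for integrating constants. *)
Lemma measurable_proper (rho : E) :
  @measurable d E = <<s dopen dE >> -> measurable F.
Proof.
move=> mE; have -> : F = \bigcup_k (F `&` cball dE rho k.+1%:R).
  rewrite -setI_bigcupr; apply/seteqP; split => [x Fx|x []//]; split => //.
  exists (Num.truncn (dE rho x)) => //; rewrite /cball /=.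
  by apply: ltW; rewrite truncnS_gt.
apply: bigcupT_measurable => k; rewrite -[X in measurable X]setCK.
apply: measurableC; rewrite mE; apply: sub_sigma_algebra.
by apply: dcompact_closed => //; exact: Fc.
Qed.

Variable q : R -> E -> R.
Hypothesis qc : forall t x, 0 < t -> F x -> forall e, 0 < e -> exists2 del, 0 < del &
     forall s y, 0 < s -> F y -> `|s - t| < del -> dE x y < del ->
       `|q s y - q t x| < e.

(** Compactness of [[a, b]] gives one modulus for all base times [t]; comparing different times is
    what later absorbs the extra step of the walk. *)
Lemma equicontinuous_at (a b : R) x e : 0 < a -> F x -> 0 < e ->
  exists2 del, 0 < del & forall t, a <= t <= b -> forall s y, 0 < s -> F y ->
    `|s - t| < del -> dE x y < del -> `|q s y - q t x| < e.
Proof.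
move=> a0 Fx e0; have [_ d0 _ _] := dm.
have /compact_near_coveringP cab := @segment_compact R a b.
have h : \forall del \near 0^'+, `[a, b]%classic `<=` (fun t => forall s y,
    0 < s -> F y -> `|s - t| < del -> dE x y < del -> `|q s y - q t x| < e).
  apply: cab => t0; rewrite /= in_itv /= => /andP[at0 _].
  have t00 : 0 < t0 by apply: lt_le_trans at0.
  have e20 : 0 < e / 2 by rewrite divr_gt0.
  have [del del0 hdel] := qc t00 Fx e20.
  near=> t del' => s y s0 Fy /= st xy.
  (* A time near [t0] may leave [[a, b]]; the second entry of the minimum keeps it positive. Both
     [(s, y)] and [(t, x)] are compared with [(t0, x)], hence the halves. *)
  have tt0 : `|t0 - t| < Num.min (del / 2) t0.
    by near: t; apply: cvgr_dist_lt; rewrite // lt_min t00 divr_gt0.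
  have d'd : del' < del / 2 by near: del'; apply: nbhs_right_lt; rewrite divr_gt0.
  move: tt0; rewrite lt_min => /andP[tt0 tt00].
  have t_gt0 : 0 < t by move: tt00; rewrite ltr_norml; lra.
  have tt : `|t - t0| < del by rewrite distrC; lra.
  have ss : `|s - t0| < del.
    by have := ler_distD t s t0; rewrite (distrC t t0); lra.
  have xy' : dE x y < del by lra.
  have xx : dE x x < del by rewrite (proj2 (d0 x x)).
  have := hdel s y s0 Fy ss xy'; have := hdel t x t_gt0 Fx tt xx.
  by have := ler_distD (q t0 x) (q s y) (q t x); rewrite (distrC (q t0 x)); lra.
have [del [del0 hd]] : exists del, 0 < del /\ `[a, b]%classic `<=` (fun t => forall s y,
    0 < s -> F y -> `|s - t| < del -> dE x y < del -> `|q s y - q t x| < e).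
  by apply: (@filter_ex _ 0^'+); apply: filterI => //; exact: nbhs_right_gt.
by exists del => // t tab; apply: hd; rewrite /= in_itv.
Unshelve. all: by end_near. Qed.

Lemma equicontinuous_on (a b : R) x0 r e : 0 < a -> 0 < r -> 0 < e ->
  exists2 del, 0 < del & forall t x y, a <= t <= b ->
    F x -> dE x0 x <= r -> F y -> dE x y < del -> `|q t y - q t x| < e.
Proof.
move=> a0 r0 e0; have [_ d0 dsym dtri] := dm.
have h : \forall del \near 0^'+, forall x, (F `&` cball dE x0 r) x ->
    forall t y, a <= t <= b -> F y -> dE x y < del -> `|q t y - q t x| < e.
  apply: near_dcompact; [exact: dm|exact: Fc|] => x [Fx _].
  have e20 : 0 < e / 2 by rewrite divr_gt0.
  have [del del0 hdel] := equicontinuous_at b a0 Fx e20.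
  have del20 : 0 < del / 2 by rewrite divr_gt0.
  exists (del / 2) => //; near=> del' => y [Fy _] xy t z tab Fz yz.
  have d'd : del' < del / 2 by near: del'; exact: nbhs_right_lt.
  have t_gt0 : 0 < t by lra.
  have tt : `|t - t| < del by rewrite subrr normr0.
  have h1 := hdel _ tab _ _ t_gt0 Fy tt; have h2 := hdel _ tab _ _ t_gt0 Fz tt.
  have := ler_distD (q t x) (q t z) (q t y); rewrite (distrC (q t x)).
  by have := dtri x y z; have := h1 _; have := h2 _; lra.
have [del [del0 hd]] := @filter_ex _ 0^'+ _ _ (filterI (nbhs_right_gt 0) h).
exists del => // t x y tab Fx xr Fy; exact: (hd x (conj Fx xr)).
Unshelve. all: by end_near. Qed.
End proper.

(** * Random walk and heat kernel on a weighted graph *)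

Section graph.
Context (R : realType) (E : choiceType) (V : set E) (mu : E -> E -> R).
Hypothesis G : wgraph V mu.

(** A second vertex exists and is reached from [x] by a walk of positive length, whose first step
    provides a neighbour. *)
Lemma vweight_gt0 x : V x -> 0 < vweight mu x.
Proof.
have [_ [mu0 [muV [_ [lf [conn [y1 [y2 [Vy1 Vy2 y12]]]]]]]]] := G.
move=> Vx; have [y [Vy yx]] : exists y, V y /\ y <> x.
  by have [<-|] := pselect (y1 = x); [exists y2; split => // /esym|exists y1].
have [[|k] [f [f0 fk hf]]] := conn x y Vx Vy; first by rewrite -fk f0 in yx.
have xf1 : 0 < mu x (f 1%N) by rewrite -{1}f0; exact: hf.
(* Restricting to the neighbours, a finite set by local finiteness, allows one positive term to be
   split off. *)
rewrite /vweight -(fsbig_widen [set y | 0 < mu x y])//; last first.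
  by move=> z [_ /= /negP]; rewrite -leNgt => z0; apply/le_anti; rewrite z0 mu0.
rewrite (fsbigD1 (f 1%N)) //=; last exact: lf.
by rewrite ltr_pwDl// fsumr_ge0.
Qed.

Lemma vweight_ge0 x : 0 <= vweight mu x.
Proof. by have [_ [mu0 _]] := G; rewrite /vweight fsumr_ge0. Qed.

Lemma mstep_ge0 m x y : 0 <= mstep mu m x y.
Proof.
have [_ [mu0 _]] := G.
elim: m y => [|m IH] y /=; first by rewrite indicE ler0n.
by apply: fsumr_ge0 => z _; rewrite mulr_ge0// divr_ge0// vweight_ge0.
Qed.

Lemma mstep_support m x y : V x -> ~ V y -> mstep mu m x y = 0.
Proof.
have [_ [mu0 [muV _]]] := G.
case: m => [|m] Vx Vy /=.
  by rewrite indicE memNset //= => yx; apply: Vy; rewrite yx.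
apply: fsbig1 => z _; suff -> : trans mu z y = 0 by rewrite mulr0.
rewrite /trans; suff -> : mu z y = 0 by rewrite mul0r.
apply/le_anti; rewrite mu0 andbT leNgt; apply/negP => /muV[_ Vy']; exact: Vy.
Qed.

Lemma hk_q_ge0 m x y : 0 <= hk_q mu m x y.
Proof.
by rewrite mulr_ge0// addr_ge0// divr_ge0 ?vweight_ge0 ?mstep_ge0.
Qed.

(** Off [V] the step probability vanishes, and on [V] the weight is nonzero, so the division in
    [hk_p] can be undone. *)
Lemma walk_probE m x A : V x -> walk_prob mu m x A =
  (\esum_(y in A `&` V) (hk_p mu m x y * vweight mu y)%:E)%E.
Proof.
move=> Vx; rewrite /walk_prob esum_mkcondr; apply: eq_esum => y _.
case: ifPn => [/set_mem Vy|/negP yV].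
  by rewrite /hk_p divfK// gt_eqF// vweight_gt0.
by rewrite mstep_support// => Vy; apply: yV; rewrite mem_set.
Qed.

Lemma walk_probD m x A : V x ->
  (walk_prob mu m x A + walk_prob mu m.+1 x A =
   \esum_(y in A `&` V) (2 * hk_q mu m x y * vweight mu y)%:E)%E.
Proof.
move=> Vx; rewrite !walk_probE// -esumD; first last.
- by move=> y _; rewrite lee_fin mulr_ge0 ?divr_ge0 ?vweight_ge0 ?mstep_ge0.
- by move=> y _; rewrite lee_fin mulr_ge0 ?divr_ge0 ?vweight_ge0 ?mstep_ge0.
by apply: eq_esum => y _; rewrite -EFinD /hk_q mulrA divff// mul1r mulrDl.
Qed.

Lemma walk_prob_ge m x A Q e : V x -> 0 <= Q -> 0 <= e ->
  (forall y, A y -> V y -> Q <= hk_q mu m x y + e) ->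
  ((2 * Q)%:E * gmeasure V mu A <=
   walk_prob mu m x A + walk_prob mu m.+1 x A + (2 * e)%:E * gmeasure V mu A)%E.
Proof.
move=> Vx Q0 e0 h; rewrite walk_probD// /gmeasure -!esumZl ?mulr_ge0//; first last.
- by move=> y; rewrite lee_fin vweight_ge0.
- by move=> y; rewrite lee_fin vweight_ge0.
rewrite -esumD; first last.
- by move=> y _; rewrite mule_ge0 ?lee_fin ?vweight_ge0 ?mulr_ge0.
- by move=> y _; rewrite lee_fin mulr_ge0 ?vweight_ge0// mulr_ge0// hk_q_ge0.
apply: le_esum => y [Ay Vy]; rewrite -!EFinM -EFinD lee_fin -mulrDl -mulrDr.
by rewrite ler_wpM2r ?vweight_ge0 ?ler_wpM2l ?h.
Qed.

Lemma walk_prob_le m x A c : V x -> 0 <= c ->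
  (forall y, A y -> V y -> hk_q mu m x y <= c) ->
  (walk_prob mu m x A + walk_prob mu m.+1 x A <= (2 * c)%:E * gmeasure V mu A)%E.
Proof.
move=> Vx c0 h; rewrite walk_probD// /gmeasure -!esumZl ?mulr_ge0//; last first.
  by move=> y; rewrite lee_fin vweight_ge0.
apply: le_esum => y [Ay Vy]; rewrite -!EFinM lee_fin.
by rewrite ler_wpM2r ?vweight_ge0 ?ler_wpM2l ?h.
Qed.

End graph.

Lemma gdistxx (R : realType) (E : choiceType) (mu : E -> E -> R) x :
  gdist mu x x = 0.
Proof.
have w0 : [set (k%:R : R) | k in gwalk mu x x] 0.
  by exists 0%N => //; exists (fun=> x).
have lb0 : lbound [set (k%:R : R) | k in gwalk mu x x] 0.
  by move=> _ [k _ <-]; rewrite ler0n.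
apply/le_anti; rewrite ge_inf//=; last by exists 0.
by rewrite lb_le_inf//; exists 0.
Qed.

(** * The assumptions in epsilon form, and the two implications *)

Section limit.
Context (R : realType) (d : measure_display) (E : measurableType d)
  (dE : E -> E -> R) (F : set E) (rho : E)
  (nu : {measure set E -> \bar R}) (q : R -> E -> R)
  (V : nat -> set E) (mu : nat -> E -> E -> R)
  (alpha beta gamma : nat -> R) (g : nat -> E -> E).
Hypothesis dm : is_metric dE.
Hypothesis mE : @measurable d E = <<s dopen dE >>.
Hypothesis Fc : forall x r, 0 < r -> dcompact dE (F `&` cball dE x r).
Hypothesis Frho : F rho.
Hypothesis nuR : radon_on dE F nu.
Hypothesis nuF : full_support_on dE F nu.
Hypothesis qc : forall t x, 0 < t -> F x -> forall e, 0 < e -> exists2 del, 0 < del &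
     forall s y, 0 < s -> F y -> `|s - t| < del -> dE x y < del ->
       `|q s y - q t x| < e.
Hypothesis q0 : forall t x, 0 < t -> F x -> 0 <= q t x.
Hypothesis q1 : forall t, 0 < t -> (\int[nu]_(x in F) (q t x)%:E = 1)%E.
Hypothesis G : forall n, wgraph (V n) (mu n).
Hypothesis Vrho : forall n, V n rho.
Hypothesis alpha0 : forall n, 0 <= alpha n.
Hypothesis beta0 : forall n, 0 <= beta n.
Hypothesis gamma0 : forall n, 0 <= gamma n.
Hypothesis alphay : alpha @ \oo --> +oo.
Hypothesis betay : beta @ \oo --> +oo.
Hypothesis gammay : gamma @ \oo --> +oo.
Hypothesis gmin : forall n x, V n (g n x) /\ (forall y, V n y -> dE x (g n x) <= dE x y).

Let hq n (t : R) x := hk_q (mu n) (Num.truncn (gamma n * t)) rho x.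

(** The supremum in (A2) is monotone in the distance bound, so one good [del] settles all smaller
    ones. *)
Lemma assumption_A2P : assumption_A2 rho V mu alpha beta gamma <->
  forall a b r e : R, 0 < a -> a <= b -> 0 < r -> 0 < e ->
  exists2 del : R, 0 < del & \forall n \near \oo, forall x y t,
    gball (V n) (mu n) rho (alpha n * r) x ->
    gball (V n) (mu n) rho (alpha n * r) y ->
    gdist (mu n) x y <= alpha n * del -> a <= t <= b ->
    beta n * `|hq n t x - hq n t y| <= e.
Proof.
split => [A2 a b r e a0 ab r0 e0|h a b r a0 ab r0].
  have e20 : 0 < e / 2 by rewrite divr_gt0.
  have h := @cvge0_le R R 0^'+ (at_right_proper_filter 0) _ (A2 a b r a0 ab r0) _ e20.
  have [del [del0 hdel]] := @filter_ex _ 0^'+ _ _ (filterI (nbhs_right_gt 0) h).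
  exists del => //.
  have e2e : ((e / 2)%:E < e%:E)%E by rewrite lte_fin; lra.
  move: (limn_esup_lt (le_lt_trans hdel e2e)).
  apply: filterS => n /ereal_sup2_le hn x y t xB yB xy tab.
  by apply: (hn (x, y) t); rewrite /= ?in_itv.
apply: cvge0 => e e0; have [del0 del00 hdel] := h a b r e a0 ab r0 e0.
near=> del; have del_gt0 : 0 < del by near: del; exact: nbhs_right_gt.
have del_le : del <= del0 by near: del; exact: nbhs_right_le.
have ay : \forall n \near \oo, 1 <= alpha n by move/cvgryPge : alphay; exact.
apply/andP; split.
  apply: limn_esup_ge; apply: filterS ay => n an.
  (* The pair [(rho, rho)] keeps the index set nonempty, which bounds the supremum below by 0. *)
  have rB : gball (V n) (mu n) rho (alpha n * r) rho.
    by split => //; rewrite gdistxx mulr_gt0// (lt_le_trans ltr01).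
  apply: (@ereal_sup2_ge _ _ _ _ _ (fun (xy : E * E) t =>
    beta n * `|hq n t xy.1 - hq n t xy.2|) _ (rho, rho) a).
  - by split => //=; rewrite gdistxx mulr_ge0// ltW.
  - by rewrite /= in_itv /= lexx.
  - by rewrite mulr_ge0.
apply: limn_esup_le; apply: filterS hdel => n hn.
apply/ereal_sup2_le => -[x y] t [/= xB yB xy]; rewrite in_itv /= => tab.
by apply: hn => //; apply: le_trans xy _; rewrite ler_wpM2l.
Unshelve. all: by end_near. Qed.

Lemma local_limitP : local_limit dE F rho q V mu beta gamma g <->
  forall a b r e : R, 0 < a -> a <= b -> 0 < r -> 0 < e ->
  \forall n \near \oo, forall x t, F x -> dE rho x < r -> a <= t <= b ->
    `|beta n * hq n t (g n x) - q t x| <= e.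
Proof.
have [_ d0 _ _] := dm.
split => [h a b r e a0 ab r0 e0|h a b r a0 ab r0].
  apply: filterS (cvge0_le (h a b r a0 ab r0) e0) => n /ereal_sup2_le hn x t Fx xr tab.
  by apply: hn; rewrite /= ?in_itv.
apply: cvge0 => e e0; apply: filterS (h a b r e a0 ab r0 e0) => n hn.
apply/andP; split.
  apply: (@ereal_sup2_ge _ _ _ _ _ (fun x t =>
    `|beta n * hq n t (g n x) - q t x|) _ rho a) => //.
    by split => //; rewrite /oball /= (proj2 (d0 _ _)).
  by rewrite /= in_itv /= lexx.
by apply/ereal_sup2_le => x t [xr Fx]; rewrite /= in_itv /=; exact: hn.
Qed.

(** An infimum below [e] yields some vertex within [e], and [g n x] is at least as close. *)
Lemma vertex_near (r e : R) :
  (forall r : R, 0 < r ->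
     (fun n => ereal_sup [set dist_set dE x (V n) | x in oball dE rho r `&` F])
       @ \oo --> 0%E) -> 0 < r -> 0 < e ->
  \forall n \near \oo, forall x, F x -> dE rho x < r -> dE x (g n x) < e.
Proof.
move=> A1b r0 e0; have e20 : 0 < e / 2 by rewrite divr_gt0.
apply: filterS (cvge0_le (A1b r r0) e20) => n hn x Fx xr.
have : (dist_set dE x (V n) < e%:E)%E.
  apply: (@le_lt_trans _ _ (e / 2)%:E); last by rewrite lte_fin; lra.
  by apply: le_trans hn; apply: ereal_sup_ubound; exists x.
move=> /ereal_inf_lt[_ [v Vv <-]]; rewrite lte_fin.
by apply: le_lt_trans; apply: (gmin n x).2.
Qed.

(** (A2) is phrased in the graph distance; the upper bound of (A1)(a), with (A1)(b) to place [g n x]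
    near [x], converts it into a modulus for [dE]. *)
Lemma hk_q_equicontinuous (a b r e : R) :
  assumption_A1 dE F rho nu q V mu alpha beta gamma ->
  assumption_A2 rho V mu alpha beta gamma ->
  0 < a -> a <= b -> 0 < r -> 0 < e ->
  exists2 del : R, 0 < del & \forall n \near \oo, forall x y t,
    F x -> dE rho x < r -> V n y -> dE x y < del -> a <= t <= b ->
    beta n * `|hq n t y - hq n t (g n x)| <= e.
Proof.
move=> [[_ [alpha' [_ al'o A1a]]] [A1b _]] /assumption_A2P A2 a0 ab r0 e0.
have [dge0 d0 dsym dtri] := dm.
have [c2 [n0 hc2]] := A1a (r + 1) (addr_gt0 r0 ltr01).
(* [c2] may be nonpositive; [c] is a positive replacement by which one can divide. *)
pose c := Num.max c2 1.
have c1 : 1 <= c by rewrite le_max lexx orbT.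
have c0 : 0 < c by rewrite (lt_le_trans ltr01).
(* Up to the factor [alpha n], [c * (r + 1)] bounds the linear part of the graph distance from [rho]
   over the ball of radius [r + 1]; the extra 1 absorbs [alpha' n <= alpha n / 2]. *)
have cr0 : 0 < c * (r + 1) + 1 by rewrite addr_gt0// mulr_gt0// addr_gt0.
have [D D0 hD] := A2 a b _ e a0 ab cr0 e0.
(* The bound 1 keeps [y] and [g n x] in the ball of radius [r + 1]. They are less than [2 * del]
   apart, which costs at most [D / 2] in units of [alpha n]; [alpha' n] adds at most [D / 4]. *)
pose del := Num.min 1 (D / (4 * c)).
have del0 : 0 < del by rewrite lt_min ltr01 divr_gt0// mulr_gt0.
have del1 : del <= 1 by rewrite ge_min lexx.
have cdel : c * del <= D / 4.
  have : del <= D / (4 * c) by rewrite ge_min lexx orbT.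
  by rewrite invfM mulrA ler_pdivlMr// mulrC.
exists del => //; near=> n => x y t Fx xr Vy xy tab.
have an : 1 <= alpha n by near: n; move/cvgryPge : alphay; exact.
have an0 : 0 < alpha n by rewrite (lt_le_trans ltr01).
have al1 : alpha' n <= 2^-1 * alpha n by near: n; apply: al'o; rewrite invr_gt0.
have alD : alpha' n <= D / 4 * alpha n by near: n; apply: al'o; rewrite divr_gt0.
have nn0 : (n0 <= n)%N by near: n; exact: nbhs_infty_ge.
have gn : forall x, F x -> dE rho x < r -> dE x (g n x) < del.
  by near: n; exact: vertex_near.
have gx := gn x Fx xr.
have Vg : V n (g n x) by have [] := gmin n x.
have ry : oball dE rho (r + 1) y by rewrite /oball /=; have := dtri rho x y; lra.
have rg : oball dE rho (r + 1) (g n x).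
  by rewrite /oball /=; have := dtri rho x (g n x); lra.
have rr : oball dE rho (r + 1) rho.
  by rewrite /oball /= (proj2 (d0 _ _))// addr_gt0.
have bound u v : V n u -> V n v -> oball dE rho (r + 1) u ->
    oball dE rho (r + 1) v ->
    gdist (mu n) u v <= alpha n * (c * dE u v) + alpha' n.
  move=> Vu Vv ru rv; apply: (le_trans (hc2 n nn0 u v Vu Vv ru rv)).
  rewrite lerD2r [leRHS]mulrA (mulrC (alpha n)) ler_wpM2r// ler_wpM2r//.
  by rewrite le_max lexx.
have inB u : V n u -> oball dE rho (r + 1) u ->
    gball (V n) (mu n) rho (alpha n * (c * (r + 1) + 1)) u.
  move=> Vu ru; split => //; apply: (le_lt_trans (bound _ _ (Vrho n) Vu rr ru)).
  apply: (@le_lt_trans _ _ (alpha n * (c * (r + 1)) + 2^-1 * alpha n)).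
    by rewrite lerD// ler_wpM2l// ler_wpM2l ?ltW.
  by rewrite [ltRHS]mulrDr ltrD2l mulr1; lra.
have hn : forall x y t,
    gball (V n) (mu n) rho (alpha n * (c * (r + 1) + 1)) x ->
    gball (V n) (mu n) rho (alpha n * (c * (r + 1) + 1)) y ->
    gdist (mu n) x y <= alpha n * D -> a <= t <= b ->
    beta n * `|hq n t x - hq n t y| <= e by near: n.
apply: hn => //; [exact: inB|exact: inB|].
apply: (le_trans (bound _ _ Vy Vg ry rg)).
apply: (@le_trans _ _ (alpha n * (D / 2) + D / 4 * alpha n)); last first.
  by rewrite mulrC -mulrDl mulrC ler_wpM2l//; lra.
rewrite lerD// ler_wpM2l//.
have : c * dE y (g n x) <= c * (2 * del).
  rewrite ler_wpM2l// ?ltW//; have := dtri y x (g n x); rewrite (dsym y x); lra.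
by rewrite mulrCA; lra.
Unshelve. all: by end_near. Qed.

(** Positivity comes from full support, finiteness from local finiteness. *)
Lemma small_ball_measure x : F x -> exists2 r0 : R, 0 < r0 &
  forall r : R, 0 < r -> r <= r0 -> exists2 w : R, 0 < w & nu (oball dE x r) = w%:E.
Proof.
move=> Fx; have [nuI nulf _] := nuR; have [dge0 d0 _ _] := dm.
have [r0 r00 fin] := nulf x Fx; exists r0 => // r r_gt0 rr0.
have mB s : measurable (oball dE x s).
  by rewrite mE; apply: sub_sigma_algebra; exact: oball_dopen.
have pos : (0 < nu (oball dE x r))%E.
  rewrite nuI//; apply: nuF; first exact: oball_dopen.
  by exists x; split => //; rewrite /oball /= (proj2 (d0 _ _)).
have : (nu (oball dE x r) < +oo)%E.
  apply: le_lt_trans fin; apply: le_measure; [exact/mem_set|exact/mem_set|].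
  by move=> y; rewrite /oball /= => /lt_le_trans; apply.
move: pos; case: (nu _) => //= w w0 _; exists w => //.
Qed.

(** The integrand lies between the constants [K - e] and [K + e]; the bound by 1 comes from
    enlarging the domain to [F]. *)
Lemma integral_ball (t : R) x (r K e w : R) : 0 < t -> 0 <= K -> 0 <= e ->
  nu (oball dE x r) = w%:E ->
  (forall y, F y -> dE x y < r -> `|q t y - K| <= e) ->
  exists P : R, [/\ (\int[nu]_(y in oball dE x r `&` F) (q t y)%:E)%E = P%:E,
    0 <= P, P <= 1 & `|P - K * w| <= e * w].
Proof.
move=> t0 K0 e0 nuB hK; have [nuI _ _] := nuR.
set B := oball dE x r in nuB *; set I := (\int[nu]_(_ in _) _)%E.
have mB : measurable B by rewrite mE; apply: sub_sigma_algebra; exact: oball_dopen.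
have mBF : measurable (B `&` F).
  by apply: measurableI => //; exact: (measurable_proper dm Fc rho mE).
have nuBF : nu (B `&` F) = w%:E by rewrite -nuI.
have w0 : 0 <= w by rewrite -lee_fin -nuB.
have qB y : (B `&` F) y -> (0 <= (q t y)%:E)%E.
  by move=> [_ Fy]; rewrite lee_fin q0.
have I0 : (0 <= I)%E by exact: integral_ge0.
have I1 : (I <= 1)%E.
  rewrite -(q1 t0); apply: ge0_le_integral_restrict => // [y Fy|y [_ Fy]].
    by rewrite lee_fin q0.
  by split.
have Icst c : (\int[nu]_(y in B `&` F) (cst c%:E y) = (c * w)%:E)%E.
  by rewrite integral_cst// nuBF.
have Iu : (I <= ((K + e) * w)%:E)%E.
  rewrite -Icst; apply: ge0_le_integral_restrict => // [y _|y [By Fy]].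
    by rewrite lee_fin addr_ge0.
  split=> //; rewrite lee_fin; have := hK y Fy By; rewrite ler_norml; lra.
have Il : (((K - e) * w)%:E <= I)%E.
  (* The integral comparison is for nonnegative functions; if [K < e], nonnegativity of the integral
     is enough. *)
  have [Ke|Ke] := leP 0 (K - e); last first.
    by apply: le_trans I0; rewrite lee_fin mulr_le0_ge0// ltW.
  rewrite -Icst; apply: ge0_le_integral_restrict => // y [By Fy].
  split=> //; rewrite lee_fin; have := hK y Fy By; rewrite ler_norml; lra.
move: I0 I1 Iu Il; case: I => [P||]//; rewrite !lee_fin => P0 P1 Pu Pl.
by exists P; split => //; rewrite ler_norml; lra.
Qed.

(** The averaging argument at a fixed [x]. Every threshold on [n] is chosen before [t], whence
    uniformity in time. *)
Lemma local_limit_at (a b e : R) x :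
  assumption_A1 dE F rho nu q V mu alpha beta gamma ->
  assumption_A2 rho V mu alpha beta gamma ->
  F x -> 0 < a -> a <= b -> 0 < e ->
  \forall n \near \oo, forall t, a <= t <= b ->
    `|beta n * hq n t (g n x) - q t x| <= e.
Proof.
move=> A1 A2 Fx a0 ab e0; have [dge0 d0 dsym dtri] := dm.
have [_ [_ [A1c A1d]]] := A1.
(* The 10 is the loss in [ler_dist_average]. *)
pose eps := e / 10; have eps0 : 0 < eps by rewrite divr_gt0.
have [del1 del10 hdel1] := equicontinuous_at dm qc b a0 Fx eps0.
have r10 : 0 < dE rho x + 1 by rewrite ltr_wpDl.
have [del2 del20 hdel2] := hk_q_equicontinuous A1 A2 a0 ab r10 eps0.
have [r0 r00 hr0] := small_ball_measure Fx.
(* Three scales: continuity of [q], oscillation of the heat kernel, finiteness of the mass of the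
   ball. *)
pose r := Num.min (Num.min del1 del2) r0.
have r_gt0 : 0 < r by rewrite !lt_min del10 del20.
have rdel1 : r <= del1 by rewrite !ge_min lexx.
have rdel2 : r <= del2 by rewrite !ge_min lexx orbT.
have rr0 : r <= r0 by rewrite !ge_min lexx !orbT.
have [w w0 nuB] := hr0 r r_gt0 rr0.
pose eta := Num.min (w / 2) (eps * w / (w^-1 + eps)).
have wVe : 0 < w^-1 + eps by rewrite addr_gt0// invr_gt0.
have eta0 : 0 < eta by rewrite lt_min !divr_gt0// mulr_gt0.
have ew0 : 0 < eps * w by rewrite mulr_gt0.
have /(proj1 (fine_cvgP _ _))[gfin /cvgrPdist_le gcvg] :
    ((beta n)^-1%:E * gmeasure (V n) (mu n) (oball dE x r))%E @[n --> \oo] --> w%:E.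
  by rewrite -nuB; exact: A1c.
(* Once [gamma n >= 1], the shifted time [t + (gamma n)^-1] stays in [[a, b + 1]]. *)
have ab1 : a <= b + 1 by lra.
near=> n => t tab.
have bn0 : 0 < beta n by near: n; move/cvgryPgt : betay; exact.
have gn1 : 1 <= gamma n by near: n; move/cvgryPge : gammay; exact.
(* Makes the time shift smaller than [del1], so the modulus of [q] at time [t] also covers the
   shifted time. *)
have gnd : del1^-1 < gamma n by near: n; move/cvgryPgt : gammay; exact.
have gn0 : 0 < gamma n by rewrite (lt_le_trans ltr01).
have gV1 : (gamma n)^-1 <= 1 by rewrite invf_le1.
have gV0 : 0 < (gamma n)^-1 by rewrite invr_gt0.
have gVd : (gamma n)^-1 < del1 by rewrite -[del1]invrK ltf_pV2// posrE// invr_gt0.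
(* [N] is the rescaled mass of the ball. An infinite [gmeasure] would remain infinite after
   multiplication by [(beta n)^-1 > 0], against the finiteness given by convergence. *)
have [N gm hN] : exists2 N : R,
    gmeasure (V n) (mu n) (oball dE x r) = (beta n * N)%:E & `|w - N| <= eta.
  have fin : ((beta n)^-1%:E * gmeasure (V n) (mu n) (oball dE x r))%E \is a fin_num.
    by near: n.
  have : `|w - fine ((beta n)^-1%:E * gmeasure (V n) (mu n) (oball dE x r))%E| <= eta.
    by near: n; exact: gcvg.
  have bV : (0 < (beta n)^-1%:E)%E by rewrite lte_fin invr_gt0.
  move: fin; case: (gmeasure _ _ _) => [m _ hm||].
  - by exists ((beta n)^-1 * m) => //; rewrite mulVKf// gt_eqF.
  - by rewrite gt0_muley.
  - by rewrite gt0_muleNy.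
have t0 : 0 < t by case/andP: tab => /(lt_le_trans a0).
set s := t + (gamma n)^-1.
have s0 : 0 < s by rewrite addr_gt0.
have truncs : Num.truncn (gamma n * s) = (Num.truncn (gamma n * t)).+1.
  by rewrite mulrDr divff ?gt_eqF// truncnS// mulr_ge0// ltW.
have K0 := q0 t0 Fx; set K := q t x in K0 *.
have ht y : F y -> dE x y < r -> `|q t y - K| <= eps.
  move=> Fy xy; apply/ltW/hdel1 => //; rewrite ?subrr ?normr0//.
  exact: lt_le_trans xy _.
have hs y : F y -> dE x y < r -> `|q s y - K| <= eps.
  move=> Fy xy; apply/ltW/hdel1 => //; last exact: lt_le_trans xy _.
  by rewrite addrC addKr gtr0_norm.
have [P [IP P0 P1 hP]] := integral_ball t0 K0 (ltW eps0) nuB ht.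
have [P' [IP' _ _ hP']] := integral_ball s0 K0 (ltW eps0) nuB hs.
have hA1d : forall t, a <= t <= b + 1 ->
    (`|walk_prob (mu n) (Num.truncn (gamma n * t)) rho (oball dE x r)
       - \int[nu]_(y in oball dE x r `&` F) (q t y)%:E| <= (eps * w)%:E)%E.
  by near: n; exact: A1d.
have tab1 : a <= t <= b + 1.
  by case/andP: tab => -> tb /=; rewrite (le_trans tb)// lerDl.
have sab1 : a <= s <= b + 1.
  by case/andP: tab => ta tb; rewrite /s lerD// andbT ler_wpDr// ltW.
have := hA1d s sab1; rewrite IP' truncs => /abseB_le_EFin[W' WE' hW'].
have := hA1d t tab1; rewrite IP => /abseB_le_EFin[W WE hW].
have osc : forall x' y t, F x' -> dE rho x' < dE rho x + 1 -> V n y ->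
    dE x' y < del2 -> a <= t <= b ->
    beta n * `|hq n t y - hq n t (g n x')| <= eps by near: n.
have rx : dE rho x < dE rho x + 1 by rewrite ltrDl.
set Q := hq n t (g n x).
have Q0 : 0 <= Q by exact: hk_q_ge0.
have {}osc y : oball dE x r y -> V n y -> `|hq n t y - Q| <= eps / beta n.
  move=> xy Vy; rewrite ler_pdivlMr// mulrC; apply: osc => //.
  exact: lt_le_trans xy _.
have eb0 : 0 <= eps / beta n by rewrite divr_ge0// ltW.
have /(walk_prob_ge (G n) (Vrho n) Q0 eb0) :
    forall y, oball dE x r y -> V n y -> Q <= hq n t y + eps / beta n.
  by move=> y xy Vy; apply: ler_distlCDr; exact: osc.
have /(walk_prob_le (G n) (Vrho n) (addr_ge0 Q0 eb0)) :
    forall y, oball dE x r y -> V n y -> hq n t y <= Q + eps / beta n.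
  by move=> y xy Vy; apply: ler_distlDr; exact: osc.
rewrite WE WE' gm -!EFinM -!EFinD !lee_fin.
(* The factor [beta n] of the mass cancels the [beta n] dividing the oscillation error. *)
have -> : 2 * (Q + eps / beta n) * (beta n * N) = 2 * (beta n * Q * N) + 2 * (eps * N).
  by field; rewrite gt_eqF.
have -> : 2 * Q * (beta n * N) = 2 * (beta n * Q * N) by ring.
have -> : 2 * (eps / beta n) * (beta n * N) = 2 * (eps * N).
  by field; rewrite gt_eqF.
move=> Wu Wl; have -> : e = 10 * eps by rewrite /eps; field.
exact: (ler_dist_average w0 eps0 K0 P1 hP hP' hW hW' Wu Wl hN).
Unshelve. all: by end_near. Qed.

(** Three errors of [e / 3] for [y] near a centre [x]: from [g n y] to [g n x] by equicontinuity,
    the limit at [x], and continuity of [q] from [x] to [y]. Compactness reduces to finitely many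
    centres. *)
Lemma local_limit_of_A2 :
  assumption_A1 dE F rho nu q V mu alpha beta gamma ->
  assumption_A2 rho V mu alpha beta gamma ->
  local_limit dE F rho q V mu beta gamma g.
Proof.
move=> A1 A2; apply/local_limitP => a b r e a0 ab r0 e0.
have [dge0 d0 dsym dtri] := dm; have [_ [A1b _]] := A1.
have e30 : 0 < e / 3 by rewrite divr_gt0.
have r10 : 0 < r + 1 by rewrite addr_gt0.
have [del1 del10 hdel1] := hk_q_equicontinuous A1 A2 a0 ab r10 e30.
(* Half for the distance from [x] to [y], half for that from [y] to [g n y]. *)
have del120 : 0 < del1 / 2 by rewrite divr_gt0.
suff : \forall n \near \oo, forall x, (F `&` cball dE rho r) x ->
    forall t, a <= t <= b -> `|beta n * hq n t (g n x) - q t x| <= e.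
  by apply: filterS => n hn x t Fx /ltW xr; exact: hn.
apply: near_dcompact; [exact: dm|exact: Fc|] => x [Fx xr].
have [del2 del20 hdel2] := equicontinuous_at dm qc b a0 Fx e30.
exists (Num.min (del1 / 2) del2); first by rewrite lt_min del120.
near=> n => y [Fy yr]; rewrite lt_min => /andP[xy1 xy2] t tab.
have gnear : forall x, F x -> dE rho x < r + 1 -> dE x (g n x) < del1 / 2.
  by near: n; exact: vertex_near.
have osc : forall x y t, F x -> dE rho x < r + 1 -> V n y -> dE x y < del1 ->
    a <= t <= b -> beta n * `|hq n t y - hq n t (g n x)| <= e / 3 by near: n.
have lim_x : forall t, a <= t <= b -> `|beta n * hq n t (g n x) - q t x| <= e / 3.
  by near: n; exact: local_limit_at.
have ltr1 z : cball dE rho r z -> dE rho z < r + 1.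
  by rewrite /cball /= => zr; lra.
have gy := gnear y Fy (ltr1 y yr).
have xgy : dE x (g n y) < del1 by have := dtri x y (g n y); lra.
have := osc x (g n y) t Fx (ltr1 x xr) (gmin n y).1 xgy tab.
rewrite -{1}(ger0_norm (beta0 n)) -normrM mulrBr.
have := lim_x t tab; have t0 : 0 < t by lra.
have := hdel2 t tab t y t0 Fy; rewrite subrr normr0 => /(_ del20 xy2).
rewrite !ltr_norml !ler_norml; lra.
Unshelve. all: by end_near. Qed.

(** The heat kernel at [x] and at [y] is compared with [q t x] and [q t y], which are close to each
    other; each of the three errors is [e / 3]. *)
Lemma A2_of_local_limit : (forall n, V n `<=` F) ->
  assumption_A1 dE F rho nu q V mu alpha beta gamma ->
  local_limit dE F rho q V mu beta gamma g ->
  assumption_A2 rho V mu alpha beta gamma.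
Proof.
move=> VF [[[c c0 hc] _] _] /local_limitP ll.
apply/assumption_A2P => a b r e a0 ab r0 e0; have [dge0 d0 dsym dtri] := dm.
have e30 : 0 < e / 3 by rewrite divr_gt0.
have rc0 : 0 < r / c by rewrite divr_gt0.
have [del del0 hdel] := equicontinuous_on dm Fc qc b rho a0 rc0 e30.
(* The lower bound of (A1)(a) turns this graph distance into [dE x y <= del / 2]; halving provides
   the strict inequality. *)
exists (c * (del / 2)); first by rewrite !mulr_gt0// invr_gt0.
near=> n => x y t [Vx xr] [Vy yr] xy tab.
have an : 1 <= alpha n by near: n; move/cvgryPge : alphay; exact.
have an0 : 0 < alpha n by rewrite (lt_le_trans ltr01).
have can : 0 < c * alpha n by rewrite mulr_gt0.
(* By the same lower bound, the graph ball of radius [alpha n * r] lies in a fixed metric ball,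
   where the modulus of [q] is uniform. *)
have inB z : V n z -> gdist (mu n) rho z < alpha n * r -> dE rho z < r / c.
  move=> Vz zr; rewrite ltr_pdivlMr// -(ltr_pM2l an0).
  apply: le_lt_trans zr; have := hc n rho z (Vrho n) Vz.
  by rewrite mulrCA mulrAC mulrC; lra.
have xy' : dE x y < del.
  apply: (@le_lt_trans _ _ (del / 2)); last by lra.
  rewrite -(ler_pM2l can); apply: (le_trans (hc n x y Vx Vy)); apply: (le_trans xy).
  by rewrite mulrA (mulrC c).
have gid z : V n z -> g n z = z.
  move=> Vz; apply/esym/d0/le_anti; rewrite dge0 andbT.
  by have := (gmin n z).2 z Vz; rewrite (proj2 (d0 z z)).
have hn : forall x t, F x -> dE rho x < r / c -> a <= t <= b ->
    `|beta n * hq n t (g n x) - q t x| <= e / 3 by near: n; exact: ll.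
rewrite -(ger0_norm (beta0 n)) -normrM mulrBr.
have := hn x t (VF n x Vx) (inB x Vx xr) tab.
have := hn y t (VF n y Vy) (inB y Vy yr) tab; rewrite !gid//.
have := hdel t x y tab (VF n x Vx) (ltW (inB x Vx xr)) (VF n y Vy) xy'.
rewrite !ltr_norml !ler_norml; lra.
Unshelve. all: by end_near. Qed.
End limit.

Theorem theorem1p1 (R : realType) (d : measure_display) (E : measurableType d)
  (dE : E -> E -> R) (F : set E) (rho : E)
  (nu : {measure set E -> \bar R}) (q : R -> E -> R)
  (V : nat -> set E) (mu : nat -> E -> E -> R)
  (alpha beta gamma : nat -> R) (g : nat -> E -> E) :
  (* (E, d_E) is a metric space; measurable sets of E are its Borel sets *)
  is_metric dE ->
  @measurable d E = <<s dopen dE >> ->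
  (* F cap \bar B_E(x,r) is compact *)
  (forall x r, 0 < r -> dcompact dE (F `&` cball dE x r)) ->
  F rho ->
  (* nu: Radon measure of full support on (F, d_F), seen on E *)
  radon_on dE F nu -> full_support_on dE F nu ->
  (* q jointly continuous on (0,oo) x F, nonnegative, of total mass 1 *)
  (forall t x, 0 < t -> F x -> forall e, 0 < e -> exists2 del, 0 < del &
     forall s y, 0 < s -> F y -> `|s - t| < del -> dE x y < del ->
       `|q s y - q t x| < e) ->
  (forall t x, 0 < t -> F x -> 0 <= q t x) ->
  (forall t, 0 < t -> (\int[nu]_(x in F) (q t x)%:E = 1)%E) ->
  (* the graphs G^n, with V(G^n) in E and rho(G^n) = rho *)
  (forall n, wgraph (V n) (mu n)) ->
  (forall n, V n rho) ->
  (* scaling sequences: nonnegative and diverging to infinity *)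
  (forall n, 0 <= alpha n) -> (forall n, 0 <= beta n) -> (forall n, 0 <= gamma n) ->
  alpha @ \oo --> +oo -> beta @ \oo --> +oo -> gamma @ \oo --> +oo ->
  (* g n x is a point of V(G^n) minimising d_E(x, .) over V(G^n) *)
  (forall n x, V n (g n x) /\ (forall y, V n y -> dE x (g n x) <= dE x y)) ->
  (assumption_A1 dE F rho nu q V mu alpha beta gamma ->
   assumption_A2 rho V mu alpha beta gamma ->
   local_limit dE F rho q V mu beta gamma g)
  /\
  ((forall n, V n `<=` F) ->
   assumption_A1 dE F rho nu q V mu alpha beta gamma ->
   local_limit dE F rho q V mu beta gamma g ->
   assumption_A2 rho V mu alpha beta gamma).
Proof.
move=> dm mE Fc Frho nuR nuF qc q0 q1 G Vrho alpha0 beta0 gamma0.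
move=> alphay betay gammay gmin; split.
- exact: local_limit_of_A2.
- exact: A2_of_local_limit.
Qed.
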